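(* Let $G_1$ be a hyperbolic graph and let $G_2$ be a non-trivial bounded graph. If there is some constant $K>0$ such that $d_{G_1}(w,\mathfrak{C}(G_1))\le K$ for every vertex $w\in V(G_1)$, then the direct product $G_1\times G_2$ is hyperbolic.
   Context: Conventions. A graph $G$ (such as $G_1,G_2$) is a nonempty, connected, simple (no loops, no multiple edges), possibly infinite graph; every edge has length $1$, and $G$ is regarded as a geodesic metric space by identifying each edge isometrically with $[0,1]$ and using the shortest-path distance $d_G$ (so points of $G$ are vertices and interior points of edges). A graph is trivial if it has exactly one vertex, and bounded if it has finite diameter. A cycle is a simple closed curve (a closed path with no repeated vertices except first = last); it is odd if its length is odd. $L$ denotes length. A $u,v$-walk is a path joining $u$ and $v$ in which repeated vertices are allowed. Minimal cycles: a $u,v$-walk $g$ in $G$ is a shortcut of a cycle $C$ if $g\cap C=\{u,v\}$ and $L(g)<d_C(u,v)$, where $d_C$ is the length metric on $C$. A cycle $C'$ is a reduction of the cycle $C$ if both have odd length and $C'$ is the union of a subarc $\eta$ of $C$ and a shortcut of $C$ joining the endpoints of $\eta$. A cycle is minimal if it has odd length and has no reduction. $\mathfrak{C}(G)$ denotes the set of minimal cycles of $G$, and $d_G(u,\mathfrak{C}(G)):=\inf\{d_G(u,C): C\in\mathfrak{C}(G)\}$. Direct product: $G_1\times G_2$ has vertex set $V(G_1)\times V(G_2)$, and $(u_1,v_1)$, $(u_2,v_2)$ are adjacent iff $[u_1,u_2]\in E(G_1)$ and $[v_1,v_2]\in E(G_2)$. Hyperbolicity: in a geodesic metric space $X$,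 a geodesic triangle is the union of three geodesics $[x_1x_2],[x_2x_3],[x_3x_1]$; it is $\delta$-thin if each side is contained in the $\delta$-neighborhood of the union of the other two sides. $\delta(T)$ is the infimum of $\delta\ge 0$ such that $T$ is $\delta$-thin, $\delta(X):=\sup_T\delta(T)$ over all geodesic triangles $T$ in $X$, and $X$ is hyperbolic if $\delta(X)<\infty$. If $X$ has connected components $X_i$, then $\delta(X):=\sup_i\delta(X_i)$, and $X$ is hyperbolic if $\delta(X)<\infty$. *)

(* Defs.v *)
From HB Require Import structures.
From mathcomp Require Import all_boot all_order all_algebra.
From mathcomp Require Import all_classical all_reals all_analysis.

Set Implicit Arguments.
Unset Strict Implicit.
Unset Printing Implicit Defensive.

Import Order.TTheory GRing.Theory Num.Theory.
Local Open Scope classical_set_scope.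
Local Open Scope ring_scope.

(* A simple graph, possibly infinite and possibly disconnected.  Asking for an
   eqType and a boolean adjacency is no restriction in classical logic. *)
Record sgraph := SGraph {
  vertex :> eqType;
  adj : rel vertex;
  adj_sym : symmetric adj;
  adj_irr : irreflexive adj }.

(* [x :: p] is the vertex sequence of a walk, so its length is [size p]. *)
Definition is_walk (G : sgraph) (x y : G) (p : seq G) : Prop :=
  path (@adj G) x p /\ last x p = y.

Definition joined (G : sgraph) (x y : G) : Prop := exists p, is_walk x y p.

Definition connected_graph (G : sgraph) : Prop :=
  inhabited G /\ forall x y : G, joined x y.

Definition trivial_graph (G : sgraph) : Prop :=
  exists x : G, forall y : G, y = x.

Definition dprod_adj (G1 G2 : sgraph) : rel (G1 * G2)%type :=
  fun x y => adj x.1 y.1 && adj x.2 y.2.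

Lemma dprod_adj_sym (G1 G2 : sgraph) : symmetric (@dprod_adj G1 G2).
Proof.
by move=> x y; rewrite /dprod_adj (@adj_sym G1 x.1) (@adj_sym G2 x.2).
Qed.

Lemma dprod_adj_irr (G1 G2 : sgraph) : irreflexive (@dprod_adj G1 G2).
Proof. by move=> x; rewrite /dprod_adj adj_irr. Qed.

Definition direct_product (G1 G2 : sgraph) : sgraph :=
  @SGraph (G1 * G2)%type (@dprod_adj G1 G2)
    (@dprod_adj_sym G1 G2) (@dprod_adj_irr G1 G2).

(* Hyperbolicity of a subspace [X] of a type [T] carrying a distance [d]
   (with value +oo between different connected components). *)

Definition dist_set (R : realType) (T : Type) (d : T -> T -> \bar R)
    (x : T) (A : set T) : \bar R :=
  ereal_inf [set d x y | y in A].

(* [S] is the image of a geodesic from [x] to [y] in [X]. *)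
Definition geodesic (R : realType) (T : Type) (d : T -> T -> \bar R)
    (X : set T) (x y : T) (S : set T) : Prop :=
  exists (L : R) (g : R -> T),
    [/\ 0 <= L, g 0 = x, g L = y,
        (forall s t : R, 0 <= s <= L -> 0 <= t <= L ->
           d (g s) (g t) = `|s - t|%:E) &
        S = [set g s | s in [set s : R | 0 <= s <= L]] /\ S `<=` X].

Definition geodesic_triangle (R : realType) (T : Type) (d : T -> T -> \bar R)
    (X A B C : set T) : Prop :=
  exists x1 x2 x3 : T,
    [/\ geodesic d X x1 x2 A, geodesic d X x2 x3 B & geodesic d X x3 x1 C].

Definition thin (R : realType) (T : Type) (d : T -> T -> \bar R)
    (delta : R) (A B C : set T) : Prop :=
  [/\ forall p, A p -> (dist_set d p (B `|` C) <= delta%:E)%E,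
      forall p, B p -> (dist_set d p (C `|` A) <= delta%:E)%E &
      forall p, C p -> (dist_set d p (A `|` B) <= delta%:E)%E].

Definition delta_triangle (R : realType) (T : Type) (d : T -> T -> \bar R)
    (A B C : set T) : \bar R :=
  ereal_inf [set delta%:E | delta in
    [set delta : R | 0 <= delta /\ thin d delta A B C]].

Definition delta_space (R : realType) (T : Type) (d : T -> T -> \bar R)
    (X : set T) : \bar R :=
  ereal_sup [set r | exists A B C : set T,
    geodesic_triangle d X A B C /\ r = delta_triangle d A B C].

(* Points of the metric graph are given by their barycentric coordinates, as
   functions G -> R: [edge_point x y t] is the point at distance t from x on
   the edge [x, y].  For x = y it is the vertex x, whatever t. *)
Definition edge_point (R : realType) (G : sgraph) (x y : G) (t : R) : G -> R :=
  fun z => (1 - t) * (z == x)%:R + t * (z == y)%:R.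

Definition vertex_point (R : realType) (G : sgraph) (x : G) : G -> R :=
  fun z => (z == x)%:R.

Definition closed_edge (R : realType) (G : sgraph) (x y : G) : set (G -> R) :=
  [set edge_point x y t | t in [set t : R | 0 <= t <= 1]].

(* The metric graph spanned by a set of vertices; [metric_graph setT] is the
   whole of G.  The case x = y keeps isolated vertices. *)
Definition metric_graph (R : realType) (G : sgraph) (A : set G) :
    set (G -> R) :=
  [set p | exists x y : G,
    [/\ A x, A y, x = y \/ adj x y & closed_edge x y p]].

(* [path_length p q l]: some concatenation of finitely many subsegments of
   edges joins p to q and has total length l. *)
Inductive path_length (R : realType) (G : sgraph) :
    (G -> R) -> (G -> R) -> R -> Prop :=
| path_length_nil p : metric_graph setT p -> path_length p p 0
| path_length_cons (x y : G) (s t : R) q l :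
    adj x y -> 0 <= s <= 1 -> 0 <= t <= 1 ->
    path_length (edge_point x y t) q l ->
    path_length (edge_point x y s) q (`|s - t| + l).

Definition dist (R : realType) (G : sgraph) (p q : G -> R) : \bar R :=
  ereal_inf [set l%:E | l in path_length p q].

Definition bounded_graph (R : realType) (G : sgraph) : Prop :=
  (ereal_sup [set r : \bar R | exists p q : G -> R,
     [/\ metric_graph setT p, metric_graph setT q & r = dist p q]] < +oo)%E.

(* A path inside a connected component never leaves it, so the restriction of
   [dist] to the component is the component's own shortest-path distance. *)
Definition component (R : realType) (G : sgraph) (x : G) : set (G -> R) :=
  metric_graph [set y | joined x y].

Definition delta_graph (R : realType) (G : sgraph) : \bar R :=
  ereal_sup [set delta_space (@dist R G) (component x) | x in [set: G]].

Definition hyperbolic (R : realType) (G : sgraph) : Prop :=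
  (delta_graph R G < +oo)%E.

(* Set of points of the walk with the given vertex sequence. *)
Fixpoint trace (R : realType) (G : sgraph) (s : seq G) : set (G -> R) :=
  match s with
  | [::] => set0
  | x :: s' => match s' with
               | [::] => [set vertex_point R x]
               | y :: _ => closed_edge x y `|` trace s'
               end
  end.

(* A cycle is listed by its vertices, without repeating the first one at the
   end, so its length is [size c]. *)
Definition is_cycle (G : sgraph) (c : seq G) : bool :=
  ucycleb (@adj G) c && (2 < size c)%N.

Definition cycle_trace (R : realType) (G : sgraph) (c : seq G) : set (G -> R) :=
  if c is x :: _ then trace (rcons c x) else set0.

(* [arc c x y] (from path.v) runs along c from x and stops just before y. *)
Definition subarc_trace (R : realType) (G : sgraph) (c : seq G) (x y : G) :
    set (G -> R) :=
  trace (rcons (arc c x y) y).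

Definition cycle_dist (G : sgraph) (c : seq G) (x y : G) : nat :=
  minn (size (arc c x y)) (size (arc c y x)).

Definition shortcut (R : realType) (G : sgraph) (c : seq G) (x y : G)
    (g : seq G) : Prop :=
  [/\ x \in c, y \in c, is_walk x y g,
      trace (x :: g) `&` cycle_trace c
        = [set vertex_point R x; vertex_point R y] &
      (size g < cycle_dist c x y)%N].

(* The two subarcs of c with given endpoints are obtained from the two
   orderings of these endpoints; walks can be reversed. *)
Definition reduction (R : realType) (G : sgraph) (c c' : seq G) : Prop :=
  [/\ is_cycle c, is_cycle c', odd (size c), odd (size c') &
      exists (x y : G) (g : seq G),
        shortcut R c x y g /\
        cycle_trace c' = subarc_trace c x y `|` trace (x :: g)
          :> set (G -> R)].

Definition minimal_cycle (R : realType) (G : sgraph) (c : seq G) : Prop :=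
  [/\ is_cycle c, odd (size c) & ~ exists c', reduction R c c'].

(* Equal to +oo when there is no minimal cycle. *)
Definition dist_minimal_cycles (R : realType) (G : sgraph) (p : G -> R) :
    \bar R :=
  ereal_inf [set dist_set (@dist R G) p (cycle_trace c) |
              c in [set c | minimal_cycle R c]].

(* Main.v *)
(* A minimal cycle is isometrically embedded: of the pairs of its vertices
   violating this, a closest one is joined by a geodesic which is a shortcut,
   and, the cycle being odd, one of the two cycles formed by the shortcut and
   a subarc is odd again, hence a reduction. An isometric cycle in a
   hyperbolic graph has bounded length (apply the four-point condition to
   four equally spaced vertices), so every vertex of G1 lies on an odd closed
   walk of bounded length. Such a walk corrects the parity of a walk of G1,
   and then the walk can be paired with one of G2; thus distances in G1 x G2
   and in G1 differ by a bounded amount. The four-point form of hyperbolicity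
   is stable under bounded perturbations of the distance, so it passes from
   G1 to G1 x G2. *)

Require Import Defs.
From mathcomp Require Import all_boot all_order all_algebra.
From mathcomp Require Import all_classical all_reals all_analysis.
From mathcomp Require Import zify lra.

Import Order.TTheory GRing.Theory Num.Theory.
Local Open Scope classical_set_scope.
Local Open Scope ring_scope.

Set Implicit Arguments.
Unset Strict Implicit.
Unset Printing Implicit Defensive.

(** * Walks and the graph distance *)

Definition walkn (G : sgraph) (n : nat) (x y : G) : Prop :=
  exists2 p, is_walk x y p & size p = n.

Lemma walkn0 (G : sgraph) (x : G) : walkn 0 x x.
Proof. by exists [::]. Qed.

Lemma walkn1 (G : sgraph) (x y : G) : adj x y -> walkn 1 x y.
Proof. by move=> xy; exists [:: y] => //; split; rewrite //= xy. Qed.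

Lemma walkn_cat (G : sgraph) m n (x y z : G) :
  walkn m x y -> walkn n y z -> walkn (m + n) x z.
Proof.
move=> [p [pp lp] <-] [q [pq lq] <-]; exists (p ++ q); last by rewrite size_cat.
by split; rewrite ?cat_path ?last_cat lp ?pp.
Qed.

Lemma walkn_split (G : sgraph) m n (x z : G) :
  walkn (m + n) x z -> exists y, walkn m x y /\ walkn n y z.
Proof.
move=> [p [pp lp] sp]; exists (last x (take m p)).
move: pp lp; rewrite -{1 2}(cat_take_drop m p) cat_path last_cat.
move=> /andP[p1 p2] lp; split.
  by exists (take m p) => //; rewrite size_takel // sp leq_addr.
by exists (drop m p) => //; rewrite size_drop sp addKn.
Qed.

Lemma walkn_sym (G : sgraph) n (x y : G) : walkn n x y -> walkn n y x.
Proof.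
elim: n x => [|n IH] x.
  by case=> [[|//]] [_ /= <-] _; exact: walkn0.
case=> [[//|z p]] [/= /andP[xz pz] lp] [sp].
have yz : walkn n y z by apply: IH; exists p.
by rewrite -addn1; apply: walkn_cat yz _; apply: walkn1; rewrite adj_sym.
Qed.

(** The value [0] is a default when no walk joins [x] to [y], so this is the graph distance between
    joined vertices only. *)
Definition gdist (G : sgraph) (x y : G) : nat :=
  if pselect (exists n, `[< walkn n x y >]) is left h then ex_minn h else 0%N.

Lemma gdist_le (G : sgraph) n (x y : G) : walkn n x y -> (gdist x y <= n)%N.
Proof.
rewrite /gdist; case: pselect => // h w.
by case: ex_minnP => m _; apply; apply/asboolP.
Qed.

Lemma walkn_gdist (G : sgraph) (x y : G) : joined x y -> walkn (gdist x y) x y.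
Proof.
move=> [p wp]; rewrite /gdist; case: pselect => [h|[]].
  by case: ex_minnP => m /asboolP.
by exists (size p); apply/asboolP; exists p.
Qed.

Lemma gdistxx (G : sgraph) (x : G) : gdist x x = 0%N.
Proof. by have := gdist_le (walkn0 x); lia. Qed.

Section GraphDistance.
Variable G : sgraph.
Hypothesis conn : forall x y : G, joined x y.
Implicit Types w x y z p q : G.

Lemma gdist_sym x y : gdist x y = gdist y x.
Proof.
apply/eqP; rewrite eqn_leq.
by apply/andP; split; apply/gdist_le/walkn_sym/walkn_gdist.
Qed.

Lemma gdist_tri y x z : (gdist x z <= gdist x y + gdist y z)%N.
Proof. by apply/gdist_le/(walkn_cat (walkn_gdist _) (walkn_gdist _)). Qed.

Lemma gdist_eq0 x y : gdist x y = 0%N -> x = y.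
Proof.
move=> e; have := walkn_gdist (conn x y); rewrite e.
by case=> [[|//]] [_ /= ->].
Qed.

(** [p] lies on some geodesic from [x] to [y]. *)
Definition between x y p := (gdist x p + gdist p y)%N = gdist x y.

(** Thin triangles on vertices: no geodesic is chosen, and a side is the set of all vertices on some
    geodesic between its ends. *)
Definition slim (D : nat) : Prop := forall x y z p, between x y p ->
  exists q, (between x z q \/ between y z q) /\ (gdist p q <= D)%N.

(** Gromov's condition in additive form: it compares the three ways of pairing four points. *)
Definition four_point (k : nat) : Prop := forall w x y z,
  (gdist w y + gdist x z <=
   maxn (gdist x y + gdist w z) (gdist w x + gdist y z) + k)%N.

Lemma between_step p z : p <> z ->
  exists p', adj p p' /\ gdist p z = (gdist p' z).+1.
Proof.
move=> pz; have [n en] : exists n, gdist p z = n.+1.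
  by case e: (gdist p z) => [|n]; [case: pz; exact: gdist_eq0|exists n].
have := walkn_gdist (conn p z); rewrite en -[n.+1]add1n.
case/walkn_split=> p' [[[|a [|//]] //= [/=]]]; rewrite andbT => pa <- _ w.
exists a; split=> //; have := gdist_le w; have := gdist_tri a p z.
by have := gdist_le (walkn1 pa); lia.
Qed.

Lemma between_sym x y p : between x y p -> between y x p.
Proof. by rewrite /between addnC (gdist_sym y x) !(gdist_sym p) (gdist_sym x). Qed.

(** Adding the triangle inequalities through [a] and [b] bounds [gdist w p] by the Gromov product of
    [x] and [z] at [w] plus [2 * d]. *)
Lemma between_close d w x z p a b : between x z p ->
  between w x a -> between w z b -> (gdist p a <= d)%N -> (gdist p b <= d)%N ->
  (2 * gdist w p + gdist x z <= gdist w x + gdist w z + 4 * d)%N.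
Proof.
rewrite /between => bp ba bb pa pb.
have := gdist_tri a w p; have := gdist_tri b w p.
have := gdist_tri a x p; have := gdist_tri b p z.
by rewrite (gdist_sym a p) (gdist_sym b p) (gdist_sym x a); lia.
Qed.

(* Walking from x to z along a geodesic, there is a moment where one passes
   from the side [w, x] to the side [w, z]; there one is close to both. *)
Lemma slim_center D w x z : slim D -> exists p, between x z p /\
  (2 * gdist w p + gdist x z <= gdist w x + gdist w z + 4 * D.+1)%N.
Proof.
move=> sl.
suff H n p : gdist p z = n -> between x z p ->
    (exists q, between w x q /\ gdist p q <= D)%N -> exists p, between x z p /\
  (2 * gdist w p + gdist x z <= gdist w x + gdist w z + 4 * D.+1)%N.
  apply: (H _ x erefl); first by rewrite /between gdistxx.
  by exists x; split; rewrite /between gdistxx ?addn0.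
elim: n p => [|n IH] p pz bp [q [bq pq]].
  have e := gdist_eq0 pz; exists p; split=> //.
  apply: (@between_close _ _ _ _ _ q p) => //; rewrite ?gdistxx //; last by lia.
  by rewrite e /between gdistxx addn0.
have npz : p <> z by move=> e; move: pz; rewrite e gdistxx.
have [p' [pp' e]] := between_step npz.
have bp' : between x z p'.
  move: bp; rewrite /between => bp; have := gdist_tri p x p'.
  by have := gdist_tri p' x z; have := gdist_le (walkn1 pp'); lia.
have [r [[br|br] pr]] := sl x z w p' bp'.
  by apply: (IH p') => //; [lia|exists r; split=> //; exact: between_sym].
(* [p] is close to the side towards [x] and its successor [p'] to the side towards [z]; the step
   between them costs the extra [1] in [D.+1]. *)
exists p; split=> //; apply: (@between_close _ _ _ _ _ q r) => //.
- exact: between_sym.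
- by lia.
- by have := gdist_tri p' p r; have := gdist_le (walkn1 pp'); lia.
Qed.

(** The vertex [p] from [slim_center] is within [D] of some [q] on a side ending at [y]. Estimating
    distances from [w] through [q] loses [2 * D], on top of the [4 * D.+1] already lost. *)
Lemma slim_four_point D : slim D -> four_point (6 * D.+1).
Proof.
move=> sl w x y z.
have [p [bp cp]] := slim_center w x z sl.
have [q [bq pq]] := sl x z y p bp.
have t1 := gdist_tri p w q; have t2 := gdist_tri q w x.
have t3 := gdist_tri q w y; have t4 := gdist_tri q w z.
case: bq => [|/between_sym]; rewrite /between => bq.
  by move: t2; rewrite (gdist_sym q x); lia.
by move: t3; rewrite (gdist_sym q y); lia.
Qed.

End GraphDistance.

(** * Minimal cycles *)

Lemma edge_point0 (R : realType) (G : sgraph) (x y : G) :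
  edge_point x y 0 = vertex_point R x.
Proof. by apply/funext => z; rewrite /edge_point /vertex_point; lra. Qed.

Lemma edge_point1 (R : realType) (G : sgraph) (x y : G) :
  edge_point x y 1 = vertex_point R y.
Proof. by apply/funext => z; rewrite /edge_point /vertex_point; lra. Qed.

Lemma edge_pointC (R : realType) (G : sgraph) (x y : G) (t : R) :
  edge_point x y t = edge_point y x (1 - t).
Proof. by apply/funext => z; rewrite /edge_point; lra. Qed.

Lemma edge_pointxx (R : realType) (G : sgraph) (x : G) (t : R) :
  edge_point x x t = vertex_point R x.
Proof. by apply/funext => z; rewrite /edge_point /vertex_point; lra. Qed.

Lemma closed_edgeC (R : realType) (G : sgraph) (x y : G) :
  closed_edge x y = closed_edge y x :> set (G -> R).
Proof.
by apply/seteqP; split=> p [t /= tI <-]; exists (1 - t);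
  rewrite /= -?edge_pointC //; lra.
Qed.

Lemma closed_edge_l (R : realType) (G : sgraph) (x y : G) :
  closed_edge x y (vertex_point R x).
Proof. by exists 0; rewrite ?edge_point0 //=; lra. Qed.

Lemma closed_edge_r (R : realType) (G : sgraph) (x y : G) :
  closed_edge x y (vertex_point R y).
Proof. by rewrite closed_edgeC; exact: closed_edge_l. Qed.

Lemma vertex_point_neq0 (R : realType) (G : sgraph) (x z : G) :
  vertex_point R x z != 0 -> z = x.
Proof. by rewrite /vertex_point; case: (z =P x) => //=; rewrite eqxx. Qed.

Lemma vertex_pointxx (R : realType) (G : sgraph) (x : G) : vertex_point R x x = 1.
Proof. by rewrite /vertex_point eqxx. Qed.

Lemma closed_edge_supp (R : realType) (G : sgraph) (a b z : G) (p : G -> R) :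
  closed_edge a b p -> p z != 0 -> z = a \/ z = b.
Proof.
move=> [t _ <-]; rewrite /edge_point.
by case: (z =P a); case: (z =P b) => //=; auto; rewrite !mulr0 addr0 eqxx.
Qed.

(** An interior point has both ends of its edge in its support, so two edges sharing such a point
    have the same ends. *)
Lemma closed_edge_case (R : realType) (G : sgraph) (a b : G) (p : G -> R) :
  closed_edge a b p ->
  [\/ p = vertex_point R a, p = vertex_point R b | p a != 0 /\ p b != 0].
Proof.
move=> [t /= tI <-]; have [->|t0] := eqVneq t 0.
  by rewrite edge_point0; constructor 1.
have [->|t1] := eqVneq t 1; first by rewrite edge_point1; constructor 2.
have [->|ab] := eqVneq a b; first by rewrite edge_pointxx; constructor 1.
constructor 3; rewrite /edge_point !eqxx (eq_sym b a) (negbTE ab) /=.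
by rewrite !mulr1 !mulr0 addr0 add0r t0 subr_eq0 eq_sym t1.
Qed.

(** * Point sets traced by walks and cycles *)

Section Trace.
Variables (R : realType) (G : sgraph).
Implicit Types (x y z a b : G) (s t c : seq G) (p : G -> R).
Local Notation trace := (@trace R G).
Local Notation vertex_point := (@vertex_point R G).

Lemma trace_vertex s x : x \in s -> trace s (vertex_point x).
Proof.
elim: s => // y [|z s] IH; rewrite inE; first by move=> /eqP ->.
by case/predU1P => [->|xs]; [left; exact: closed_edge_l|right; exact: IH].
Qed.

Lemma trace_cat s a t : trace (s ++ a :: t) = trace (rcons s a) `|` trace (a :: t).
Proof.
elim: s => [|x s IH].
  apply/esym/setUidr => p pe; have -> : p = vertex_point a := pe.
  exact: (trace_vertex (mem_head a t)).
case: s IH => [_ /=|y s IH]; last by rewrite /= in IH *; rewrite IH setUA.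
rewrite -setUA; congr (_ `|` _); apply/esym/setUidr => p ->.
exact: (trace_vertex (mem_head a t)).
Qed.

Lemma trace_rev s : trace (rev s) = trace s.
Proof.
elim: s => // x [//|y s] IH.
rewrite rev_cons rev_cons -cats1 cat_rcons trace_cat -rev_cons IH setUC.
congr (_ `|` _); rewrite /= closed_edgeC; apply/setUidl => p ->.
exact: closed_edge_l.
Qed.

Lemma trace_edge x s p : trace (x :: s) p -> s <> [::] ->
  exists2 i, (i < size s)%N &
    closed_edge (nth x (x :: s) i) (nth x (x :: s) i.+1) p.
Proof.
elim: s x => // y s IH x [pe|ps] _; first by exists 0%N.
case: s IH ps => [_ /= ->|z s IH ps].
  by exists 0%N => //; exact: closed_edge_r.
have [//|i iz pi] := IH y ps; exists i.+1 => //=.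
rewrite (set_nth_default y) /=; last by rewrite /= in iz *; lia.
by rewrite (set_nth_default y x) /= in pi *.
Qed.

Lemma cycle_trace_next c p : uniq c -> cycle_trace c p ->
  exists2 a, a \in c & closed_edge a (next c a) p.
Proof.
case: c => // x s us; rewrite /cycle_trace rcons_cons.
move=> /trace_edge; rewrite size_rcons => edge.
have [|i si pi] := edge; first by case: (s).
exists (nth x (x :: s) i); first by rewrite mem_nth.
rewrite next_nth mem_nth // index_uniq //.
move: pi; rewrite -[x :: rcons s x]/(rcons (x :: s) x) !nth_rcons /= si.
(* At the last index both sides wrap round: the default value of [next] is the head of the cycle. *)
case: ltnP => // h; rewrite (nth_default x (s := s)); last by rewrite -ltnS.
by case: eqP.
Qed.

Lemma cycle_trace_vertex c x : x \in c -> cycle_trace c (vertex_point x).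
Proof.
by case: c => // y s xc; apply: (@trace_vertex (rcons (y :: s) y));
  rewrite mem_rcons inE xc orbT.
Qed.

End Trace.

(** * Distances along a cycle *)

Lemma size_arc (T : eqType) (c : seq T) (x y : T) :
  uniq c -> x \in c -> y \in c ->
  size (arc c x y) = (if (index x c <= index y c)%N then index y c - index x c
                      else size c + index y c - index x c)%N.
Proof.
move=> uc xc yc; rewrite /arc size_takel ?index_size // /rot index_cat.
have e := cat_take_drop (index x c) c.
have yT : (y \in take (index x c) c) = (index y c < index x c)%N by rewrite in_take.
move: uc yc; rewrite -{1 2}e cat_uniq mem_cat => /and3P[_ /hasPn nd _].
have ix : (index x c < size c)%N by rewrite index_mem.
have := index_cat y (take (index x c) c) (drop (index x c) c).
rewrite e yT size_takel ?index_size // size_drop.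
(* If [y] precedes [x] in [c], it lies in the prefix that the rotation to [x] moves to the end. *)
case: (ltnP (index y c) (index x c)) => /= h iy.
  move=> _; case: ifP => [/nd|_]; first by rewrite /= yT h.
  by rewrite -iy; lia.
by move=> ->; lia.
Qed.

Section CycleDist.
Variable G : sgraph.
Hypothesis conn : forall x y : G, joined x y.
Implicit Types (x y z : G) (c : seq G).

(** [d] is the absolute difference of the two indices, written with truncated subtraction. *)
Lemma cycle_distE c x y : uniq c -> x \in c -> y \in c ->
  let d := (index x c - index y c + (index y c - index x c))%N in
  cycle_dist c x y = minn d (size c - d).
Proof.
move=> uc xc yc; rewrite /cycle_dist !size_arc //.
by move: xc yc; rewrite -!index_mem; do !case: ifP; lia.
Qed.

Lemma cycle_dist_tri c x y z : uniq c -> x \in c -> y \in c -> z \in c ->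
  (cycle_dist c x z <= cycle_dist c x y + cycle_dist c y z)%N.
Proof.
by move=> uc xc yc zc; rewrite !cycle_distE //;
  move: xc yc zc; rewrite -!index_mem; lia.
Qed.

Lemma cycle_dist_next c x : uniq c -> x \in c -> (cycle_dist c x (next c x) <= 1)%N.
Proof.
move=> uc xc; rewrite cycle_distE ?mem_next // next_nth xc.
case: c uc xc => // y s us xc; rewrite -!index_mem in xc *.
set i := index x _ in xc *; have [si|si] := ltnP i (size s).
  by rewrite -[nth y s i]/(nth y (y :: s) i.+1) index_uniq //=; lia.
by rewrite nth_default //= eqxx; rewrite /= in xc; lia.
Qed.

Lemma gdist_cycle_dist c x y : is_cycle c -> x \in c -> y \in c ->
  (gdist x y <= cycle_dist c x y)%N.
Proof.
move=> /andP[/andP[cyc uc] _] xc yc.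
have [->|xy] := eqVneq x y; first by rewrite gdistxx.
suff H u v : u \in c -> v \in c -> u != v -> (gdist u v <= size (arc c u v))%N.
  by rewrite /cycle_dist leq_min H //= gdist_sym // H // eq_sym.
move=> ucc vc uv; have [i p1 p2 <- _ e] := rot_to_arc uc ucc vc uv.
apply: gdist_le; exists (rcons p1 v); last by rewrite size_rcons.
split; last by rewrite last_rcons.
move: cyc; rewrite -(rot_cycle i) e /= rcons_cat /= -cat_rcons cat_path.
by case/andP.
Qed.

Lemma shortest_walk x y : exists2 g, is_walk x y g &
  size g = gdist x y /\ uniq (x :: g).
Proof.
have [g [pg lg] sg] := walkn_gdist (conn x y).
case/shortenP: pg lg => g' pg' ug' sub lg'; exists g' => //; split=> //.
apply/eqP; rewrite eqn_leq gdist_le ?andbT; last by exists g'.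
by rewrite -sg uniq_leq_size //; case/andP: ug'.
Qed.

Lemma walk_between x y g z : is_walk x y g -> size g = gdist x y ->
  z \in x :: g -> between x y z.
Proof.
move=> [pg lg] sg zg; case/splitPl: zg pg lg sg => p1 p2 l1.
rewrite cat_path last_cat l1 size_cat => /andP[w1 w2] l2 sg.
have d1 : (gdist x z <= size p1)%N by apply: gdist_le; exists p1.
have d2 : (gdist z y <= size p2)%N by apply: gdist_le; exists p2.
by have := gdist_tri conn z x y; rewrite /between; lia.
Qed.

(** * Shortcuts, reductions and minimal cycles *)

Variable R : realType.

(** Since no other vertex of [c] lies between [x] and [y], a shortest walk joining them meets [c]
    only at its ends and is a shortcut. Together with the arc from [x] to [y] it bounds a cycle, odd
    by the last hypothesis. *)
Lemma shortcut_reduction c x y : is_cycle c -> odd (size c) ->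
  x \in c -> y \in c -> (gdist x y < cycle_dist c x y)%N ->
  (forall z, z \in c -> between x y z -> z = x \/ z = y) ->
  odd (size (arc c x y) + gdist x y) -> exists c', reduction R c c'.
Proof.
move=> cc oc xc yc lt inn od.
have /andP[/andP[cyc uc] _] := cc.
have xy : x != y.
  apply: contraTneq lt => <-; by rewrite gdistxx cycle_distE // subnn min0n.
have [g wg [sg ug]] := shortest_walk x y.
have bw z : z \in c -> z \in x :: g -> z = x \/ z = y.
  by move=> zc zg; apply: inn => //; exact: walk_between zg.
have sc : shortcut R c x y g.
  split=> //; last by rewrite sg.
  have [pg lg] := wg.
  have gx : x \in x :: g by rewrite mem_head.
  have gy : y \in x :: g by rewrite -lg mem_last.
  apply/seteqP; split=> [p [pg1 pc]|p [->|->]]; last 2 first.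
  - by split; [exact: trace_vertex|exact: cycle_trace_vertex].
  - by split; [exact: trace_vertex|exact: cycle_trace_vertex].
  have [|i ig] := trace_edge pg1.
    by case: (g) lg => //= e; rewrite e eqxx in xy.
  have [a ac pa] := cycle_trace_next uc pc.
  have nc : next c a \in c by rewrite mem_next.
  have vert z : z \in x :: g -> p = vertex_point R z ->
      [set vertex_point R x; vertex_point R y] p.
    move=> zg pz; have zc : z \in c.
      case: (closed_edge_supp (z := z) pa) => [|->|->] //.
      by rewrite pz vertex_pointxx oner_eq0.
    by rewrite pz; have [->|->] := bw z zc zg; [left|right].
  set u := nth _ _ i; set v := nth _ _ i.+1 => pe.
  have ug1 : u \in x :: g by rewrite mem_nth //= ltnS ltnW.
  have vg1 : v \in x :: g by rewrite mem_nth.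
  have uv : u != v.
    rewrite nth_uniq //= ?ltnS ?(ltnW ig) //.
    by rewrite -[X in X != _]addn0 -addn1 eqn_add2l.
  case: (closed_edge_case pe) => [|| [pu pv]]; [exact: vert|exact: vert|].
  (* A common interior point makes the edge of the walk an edge of [c] with ends [x] and [y]. Their
     distance along [c] is then at most [1], which leaves [0] for [gdist x y]. *)
  exfalso; have uac := closed_edge_supp pa pu; have vac := closed_edge_supp pa pv.
  have ucc : u \in c by case: uac => ->.
  have vc : v \in c by case: vac => ->.
  have d1 : (cycle_dist c x y <= 1)%N.
    have := cycle_dist_next uc ac.
    have [eu|eu] := bw u ucc ug1; have [ev|ev] := bw v vc vg1;
      rewrite eu ev ?eqxx // in uv uac vac *;
      (case: uac uv => ->; case: vac => -> //; rewrite ?eqxx //= => _);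
      by rewrite /cycle_dist minnC.
  have /eqP : gdist x y == 0%N by rewrite -leqn0 -ltnS (leq_trans lt d1).
  by move=> /(gdist_eq0 conn) e; rewrite e eqxx in xy.
have [pg lg] := wg.
have [i p1 p2 ex _ e] := rot_to_arc uc xc yc xy.
move: ug wg sg sc pg lg bw; case/lastP: g => [|g0 y'] ug wg sg sc pg lg bw.
  by rewrite /= in lg; rewrite lg eqxx in xy.
rewrite last_rcons in lg; subst y'.
have mem_rot z : z \in c = (z \in x :: p1 ++ y :: p2) by rewrite -e mem_rot.
(* The arc [x :: p1] is followed by [y] and then by the inner vertices of the walk, run backwards to
   [x]. *)
exists (x :: p1 ++ y :: rev g0).
have szc : size (x :: p1 ++ y :: rev g0) = (size (arc c x y) + gdist x y)%N.
  by rewrite -ex -sg size_rcons /= !size_cat /= size_rev.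
split=> //; last 2 first.
- by rewrite szc.
- exists x, y, (rcons g0 y); split=> //.
  rewrite /cycle_trace /subarc_trace -ex.
  rewrite rcons_cons rcons_cat rcons_cons -cat_cons trace_cat; congr (_ `|` _).
  by rewrite -[RHS]trace_rev rev_cons rev_rcons rcons_cons.
have uc' : uniq (x :: p1 ++ y :: p2) by rewrite -e rot_uniq.
apply/andP; split; last first.
  (* The walk has at least one edge and the arc is longer, so the new cycle has length at least
     [3]. *)
  rewrite szc; move: lt; rewrite /cycle_dist leq_min -ex => /andP[lt _].
  by clear -lt sg; move: lt sg; rewrite size_rcons /=; lia.
apply/andP; split.
  move: cyc; rewrite -(rot_cycle i) e /= !rcons_cat /= !cat_path /=.
  move=> /and3P[-> -> _] /=.
  move: pg; rewrite -{1}(rev_path) last_rcons belast_rcons rev_cons.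
  by rewrite (eq_path (e' := @adj G)) // => a b; rewrite adj_sym.
rewrite -cat_cons cat_uniq -rev_rcons rev_uniq; apply/and3P; split.
- by move: uc'; rewrite -cat_cons cat_uniq => /and3P[].
- apply/hasPn => z; rewrite mem_rev => zg; apply/negP => zp.
  have zc : z \in c by rewrite mem_rot -cat_cons mem_cat zp.
  have [ez|ez] := bw z zc (@mem_behead _ (x :: rcons g0 y) z zg); subst z.
    by move: ug; rewrite /= zg.
  move: uc'; rewrite -cat_cons cat_uniq => /and3P[_ /hasPn/(_ y)].
  by rewrite mem_head /= zp => /(_ isT).
by case/andP: ug.
Qed.

Lemma minimal_cycle_isometric c x y : minimal_cycle R c ->
  x \in c -> y \in c -> (cycle_dist c x y <= gdist x y)%N.
Proof.
move=> [cc oc nored]; have /andP[/andP[_ uc] _] := cc.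
have [n] := ubnP (gdist x y); elim: n x y => // n IH x y dn xc yc.
rewrite leqNgt; apply/negP => lt; apply: nored.
(* Another vertex [z] of [c] between [x] and [y] would give two closer pairs. These satisfy the
   claim by induction, and the triangle inequality along [c] would extend it to [x] and [y]. *)
have inn z : z \in c -> between x y z -> z = x \/ z = y.
  rewrite /between => zc bz; apply: contrapT => /not_orP[zx zy].
  have := IH x z; have := IH z y; have := cycle_dist_tri uc xc zc yc.
  have : gdist x z <> 0%N by move=> /(gdist_eq0 conn)/esym.
  by have : gdist z y <> 0%N by [move=> /(gdist_eq0 conn)]; lia.
have [od|ev] := boolP (odd (size (arc c x y) + gdist x y)).
  exact: shortcut_reduction xc yc lt inn od.
(* The two arcs have lengths adding up to the odd [size c], so the wrong parity for one arc is the
   right one for the other: exchange [x] and [y]. *)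
apply: (shortcut_reduction cc oc yc xc).
- by rewrite gdist_sym // /cycle_dist minnC.
- by move=> z zc /(between_sym conn) /(inn z zc) [->|->]; auto.
have xy : x != y.
  apply: contraTneq lt => ->; by rewrite gdistxx cycle_distE // subnn min0n.
have [i p1 p2 ex ey e] := rot_to_arc uc xc yc xy.
have := congr1 size e; rewrite size_rot -cat_cons size_cat ex ey => sc.
move: oc ev; rewrite sc (gdist_sym conn y) !oddD.
by case: (odd (size (arc c x y))); case: (odd (size (arc c y x)));
  case: (odd (gdist x y)).
Qed.

Lemma minimal_cycle_size k c : four_point G k -> minimal_cycle R c ->
  (size c <= 2 * k + 16)%N.
Proof.
move=> fp mc; have [cc _ _] := mc; have /andP[/andP[_ uc] sz] := cc.
have [x0 x0c] : exists x0, x0 \in c.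
  by case: (c) sz => // x s _; exists x; rewrite mem_head.
(* Four vertices at spacing [m]; the last side, from [v 3] back to [v 0], absorbs the remainder and
   has length at most [m + 3]. *)
set n := size c; set m := (n %/ 4)%N; pose v j := nth x0 c (j * m)%N.
have nm : (4 * m <= n < 4 * m + 4)%N by lia.
have vc j : (j < 4)%N -> v j \in c by move=> j4; rewrite mem_nth //; nia.
have cd i j : (i < j)%N -> (j < 4)%N -> cycle_dist c (v i) (v j) =
    minn ((j - i) * m) (n - (j - i) * m).
  move=> ij j4; rewrite /cycle_dist !size_arc ?vc ?(ltn_trans ij) //.
  rewrite /v !index_uniq //; try by nia.
  by rewrite -/n; do !case: ifP; nia.
have lo i : (i < 2)%N -> (2 * m <= gdist (v i) (v i.+2))%N.
  move=> i2; have i4 : (i < 4)%N by lia.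
  have := minimal_cycle_isometric mc (vc i i4) (vc i.+2 i2).
  by rewrite cd // -addn2 addKn; clear -nm; lia.
have up i : (i < 3)%N -> (gdist (v i) (v i.+1) <= m)%N.
  move=> i3; have i4 : (i < 4)%N by lia.
  have := gdist_cycle_dist cc (vc i i4) (vc i.+1 i3).
  by rewrite cd // -addn1 addKn; clear -nm; lia.
have up03 : (gdist (v 0%N) (v 3%N) <= m + 3)%N.
  have := gdist_cycle_dist cc (vc 0%N isT) (vc 3%N isT).
  by rewrite cd //; clear -nm; lia.
(* The diagonals have length at least [2 * m], so [4 * m <= 2 * m + 3 + k]; with [n < 4 * m + 4]
   this bounds [n]. *)
have := fp (v 0%N) (v 1%N) (v 2%N) (v 3%N).
have := lo 0%N isT; have := lo 1%N isT; have := up 0%N isT.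
have := up 1%N isT; have := up 2%N isT.
by clear -nm up03; lia.
Qed.

Lemma odd_cycle_walk c x : is_cycle c -> x \in c -> walkn (size c) x x.
Proof.
move=> /andP[/andP[cyc _] _] /rot_to[i p e]; rewrite -(size_rot i) e.
exists (rcons p x); last by rewrite size_rcons.
by split; [move: cyc; rewrite -(rot_cycle i) e|rewrite last_rcons].
Qed.

End CycleDist.

(** * Walks in the direct product *)

Lemma walknS (G : sgraph) n (x y : G) :
  walkn n.+1 x y <-> exists2 z, adj x z & walkn n z y.
Proof.
split=> [[[//|z p]] [/= /andP[xz pz] lp] [sp]|[z xz w]].
  by exists z => //; exists p.
by rewrite -add1n; apply: walkn_cat w; exact: walkn1.
Qed.

(** Going back and forth along the edge from [x] to [z] lengthens a walk by [2]. *)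
Lemma walkn_same_parity (G : sgraph) m n (x y z : G) : adj x z ->
  walkn n x y -> (n <= m)%N -> odd n = odd m -> walkn m x y.
Proof.
move=> xz w nm onm.
have [k ->] : exists k, m = (k.*2 + n)%N.
  exists (m - n)./2; have : ~~ odd (m - n) by rewrite oddB // onm addbb.
  by move=> /even_halfK ->; rewrite subnK.
elim: k => [//|k IH]; rewrite doubleS !addSn.
apply/walknS; exists z => //; apply/walknS; exists x => //.
by rewrite adj_sym.
Qed.

Lemma neighbor (G : sgraph) : connected_graph G -> ~ trivial_graph G ->
  forall x : G, exists y, adj x y.
Proof.
move=> [_ conn] nt x; apply: contrapT => iso; apply: nt; exists x => y.
case e: (gdist x y) (walkn_gdist (conn x y)) => [|n].
  by rewrite (gdist_eq0 conn e).
by case/walknS=> z xz; case: iso; exists z.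
Qed.

Section Product.
Variables G1 G2 : sgraph.
Implicit Types u v : direct_product G1 G2.

Lemma walkn_dprod n u v :
  walkn n u v <-> walkn n u.1 v.1 /\ walkn n u.2 v.2.
Proof.
elim: n u => [|n IH] u.
  split=> [[[|//]] [_ /= ->] _|]; first by split; exact: walkn0.
  case=> -[[|//]] [_ /= e1] _ [[|//]] [_ /= e2] _.
  by rewrite [v]surjective_pairing -e1 -e2 -surjective_pairing; exact: walkn0.
rewrite !walknS; split.
  case=> z /andP[a1 a2] /IH[w1 w2].
  by split; [exists z.1|exists z.2].
case=> -[z1 a1 w1] [z2 a2 w2]; exists (z1, z2); last exact/IH.
by rewrite /= /dprod_adj a1 a2.
Qed.

Lemma dprod_walk D N u v : (forall x y : G1, joined x y) ->
  connected_graph G2 -> ~ trivial_graph G2 ->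
  (forall x y : G2, gdist x y <= D)%N ->
  (forall x : G1, exists n, [/\ (n <= N)%N, odd n & walkn n x x]) ->
  exists2 n, walkn n u v & (n <= gdist u.1 v.1 + (N + D))%N.
Proof.
move=> conn1 conn2 nt bd oddw.
have [y2 a2] := neighbor conn2 nt u.2.
have [n [nN on wn]] := oddw u.1.
(* A closed walk of odd length has a first step, which provides a neighbour for backtracking. *)
have [y1 a1] : exists y, adj u.1 y.
  by case: n on wn {nN} => // n _ /walknS[y]; exists y.
have w2 := walkn_gdist (conn2.2 u.2 v.2).
have := bd u.2 v.2; set d2 := gdist _ _ in w2 * => d2D.
suff [d1 [d1N w1 od]] : exists d1, [/\ (d1 <= gdist u.1 v.1 + N)%N,
    walkn d1 u.1 v.1 & odd d1 = odd d2].
  (* With equal parities, the shorter of the two walks is prolonged by backtracking to the length of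
     the longer one. *)
  exists (maxn d1 d2); last by clear -d1N d2D; lia.
  apply/walkn_dprod; split.
    by apply: (walkn_same_parity a1 w1); rewrite ?leq_maxl // /maxn; case: ifP.
  by apply: (walkn_same_parity a2 w2); rewrite ?leq_maxr // /maxn; case: ifP.
have w1 := walkn_gdist (conn1 u.1 v.1).
have [e|ne] := eqVneq (odd (gdist u.1 v.1)) (odd d2).
  by exists (gdist u.1 v.1); rewrite leq_addr.
(* Running first through the odd closed walk at [u.1] switches the parity. *)
exists (n + gdist u.1 v.1)%N; split; [by clear -nN; lia|exact: walkn_cat w1|].
by rewrite oddD on; move: ne; do 2!case: odd.
Qed.

End Product.

(** * The metric graph *)

Section MetricGraph.
Variables (R : realType) (G : sgraph).
Implicit Types (x y z u v : G) (p q r : G -> R) (l s t : R) (g : seq G).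
Local Notation vertex_point := (@vertex_point R G).
Local Notation X := (@metric_graph R G setT).

Lemma edge_in_graph x y t : adj x y -> 0 <= t <= 1 -> X (edge_point x y t).
Proof. by move=> xy t01; exists x, y; split => //; [right|exists t]. Qed.

Lemma vertex_in_graph x : X (vertex_point x).
Proof. by exists x, x; split => //; [left|exact: closed_edge_l]. Qed.

Lemma path_length_edge x y s t : adj x y -> 0 <= s <= 1 -> 0 <= t <= 1 ->
  path_length (edge_point x y s) (edge_point x y t) `|s - t|.
Proof.
move=> xy s01 t01; rewrite -[X in path_length _ _ X]addr0.
by apply: path_length_cons => //; exact/path_length_nil/edge_in_graph.
Qed.

Lemma path_length_cat p q r l l' :
  path_length p q l -> path_length q r l' -> path_length p r (l + l').
Proof.
move=> pq; elim: pq r l' => {p q l} [p _ r l'|x y s t q l xy s01 t01 _ IH r l' qr].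
  by rewrite add0r.
by rewrite -addrA; apply: path_length_cons => //; exact: IH.
Qed.

Lemma path_length_sym p q l : path_length p q l -> path_length q p l.
Proof.
elim=> {p q l} [p Xp|x y s t q l xy s01 t01 _ IH]; first exact: path_length_nil.
by rewrite addrC distrC; apply: path_length_cat IH _; exact: path_length_edge.
Qed.

Lemma path_length_in_graph p q l : path_length p q l -> X p.
Proof. by case=> // x y s t r k xy s01 _ _; exact: edge_in_graph. Qed.

Lemma path_length_walk n x y : walkn n x y ->
  path_length (vertex_point x) (vertex_point y) n%:R.
Proof.
elim: n x => [|n IH] x.
  by case=> [[|//]] [_ /= <-] _; exact/path_length_nil/vertex_in_graph.
case/walknS=> z xz /IH; rewrite -add1n natrD; apply: path_length_cat.
have := @path_length_edge x z 0 1 xz; rewrite edge_point0 edge_point1.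
by rewrite sub0r normrN normr1 !lexx !ler01; apply.
Qed.

(* At a point p, the value 1 - p z is the distance to the endpoint z of the
   edge containing p, as soon as p z > 0. *)
Lemma path_length_endpoint p y l : path_length p (vertex_point y) l ->
  exists z n, [/\ 0 < p z, walkn n z y & n%:R + (1 - p z) <= l].
Proof.
move e: (vertex_point y) => q pq.
elim: pq e => {p q l} [p _ <-|a b s t q l ab s01 t01 _ IH /IH{IH}].
  by exists y, 0%N; rewrite vertex_pointxx; split; [lra|exact: walkn0|lra].
have nab : (a == b) = false.
  by apply/eqP => e; move: ab; rewrite e adj_irr.
have nba : (b == a) = false by rewrite eq_sym.
have va (k : R) : edge_point a b k a = 1 - k by rewrite /edge_point eqxx nab /=; lra.
have vb (k : R) : edge_point a b k b = k by rewrite /edge_point eqxx nba /=; lra.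
move=> [z [n [pz w le]]].
have st1 : s - t <= `|s - t| by exact: ler_norm.
have st3 : t - s <= `|s - t| by rewrite distrC ler_norm.
have [za|zb] : z = a \/ z = b.
- apply: (@closed_edge_supp R G a b z (edge_point a b t)); first by exists t.
  by rewrite gt_eqF.
(* For [s = 1] the starting point is the vertex [b], whose coordinate at [a] vanishes; the endpoint
   becomes [b] and the walk gains the edge to [a]. The other case is symmetric. *)
- subst z; rewrite va in pz le; have [s1|s1] := eqVneq s 1.
    exists b, n.+1; rewrite vb -natr1; split; [lra| |lra].
    by apply/walknS; exists a; rewrite // adj_sym.
  by exists a, n; rewrite va; split => //; lra.
- subst z; rewrite vb in pz le; have [s0|s0] := eqVneq s 0.
    exists a, n.+1; rewrite va -natr1; split; [lra| |lra].
    by apply/walknS; exists b.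
  by exists b, n; rewrite vb; split => //; lra.
Qed.

Lemma path_length_vertices x y l :
  path_length (vertex_point x) (vertex_point y) l ->
  exists2 n, walkn n x y & n%:R <= l.
Proof.
case/path_length_endpoint=> z [n [pz w le]].
have zx : z = x by apply: (@vertex_point_neq0 R); rewrite gt_eqF.
by exists n; [rewrite -zx|move: le; rewrite zx vertex_pointxx; lra].
Qed.

Lemma gdist_path_length x y l :
  path_length (vertex_point x) (vertex_point y) l -> (gdist x y)%:R <= l.
Proof.
case/path_length_vertices=> n w; apply: le_trans.
by rewrite ler_nat gdist_le.
Qed.

Lemma path_length_near x y p : x = y \/ adj x y -> closed_edge x y p ->
  exists2 l, 0 <= l <= 1 & path_length p (vertex_point x) l.
Proof.
move=> [->|xy] [t t01 <-].
  exists 0; first by rewrite lexx ler01.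
  by rewrite edge_pointxx; exact/path_length_nil/vertex_in_graph.
exists `|t - 0|; first by rewrite subr0 ger0_norm //; case/andP: t01.
by rewrite -(edge_point0 R x y); apply: path_length_edge; rewrite // lexx ler01.
Qed.

Lemma path_length_vertex p : X p ->
  exists v l, 0 <= l <= 1 /\ path_length p (vertex_point v) l.
Proof.
move=> [x [y [_ _ xy pxy]]].
by have [l l01 pl] := path_length_near xy pxy; exists x, l.
Qed.

Lemma dist_le p q l : path_length p q l -> (dist p q <= l%:E)%E.
Proof. by move=> pq; apply: ereal_inf_lbound; exists l. Qed.

Lemma dist_lt p q l : (dist p q < l%:E)%E ->
  exists2 l', l' < l & path_length p q l'.
Proof. by case/ereal_inf_lt=> _ [l' pq <-]; rewrite lte_fin; exists l'. Qed.

Lemma le_dist p q l : (forall l', path_length p q l' -> l <= l') ->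
  (l%:E <= dist p q)%E.
Proof.
move=> H; apply/ereal_infP => _ [l' pq <-].
by rewrite lee_fin; exact: H.
Qed.

Hypothesis conn : forall x y, joined x y.

(** Moving each point to a vertex at distance at most [1] changes the distance by at most [2]; the
    two bounds also make it finite. *)
Lemma dist_approx p q u v a b : a <= 1 -> b <= 1 ->
  path_length p (vertex_point u) a -> path_length q (vertex_point v) b ->
  exists k, dist p q = k%:E /\ `|k - (gdist u v)%:R| <= 2.
Proof.
move=> a1 b1 pu qv.
have up : (dist p q <= ((gdist u v)%:R + 2)%:E)%E.
  have := path_length_cat pu (path_length_cat
    (path_length_walk (walkn_gdist (conn u v))) (path_length_sym qv)).
  by move/dist_le/le_trans; apply; rewrite lee_fin; lra.
have lo : (((gdist u v)%:R - 2)%:E <= dist p q)%E.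
  apply: le_dist => l pq; have := path_length_cat (path_length_sym pu)
    (path_length_cat pq qv).
  by move/gdist_path_length; lra.
case e: (dist p q) up lo => [r| |] //=; rewrite !lee_fin => up lo.
by exists r; split=> //; rewrite ler_norml; lra.
Qed.

(** * Geodesics carried by shortest walks *)

Section Geodesic.
Variables (x y : G) (g : seq G).
Hypothesis (wg : is_walk x y g) (sg : size g = gdist x y).
Let w i := nth x (x :: g) i.
(** Arc-length parametrisation of the walk. At [s = size g] the second endpoint is a default value
    of [nth], harmless because the offset is [0]. *)
Let h s :=
  edge_point (w (Num.truncn s)) (w (Num.truncn s).+1) (s - (Num.truncn s)%:R).

Let adj_w i : (i < size g)%N -> adj (w i) (w i.+1).
Proof. by case: wg => /(pathP x) pg _; exact: pg. Qed.

Let walk_w i j : (i <= j <= size g)%N -> walkn (j - i) (w i) (w j).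
Proof.
case/andP=> /subnKC; move: (j - i)%N => k <-{j}.
elim: k i => [|k IH] i ik; first by rewrite addn0; exact: walkn0.
apply/walknS; exists (w i.+1); first by apply: adj_w; lia.
by rewrite -addSnnS; apply: IH; lia.
Qed.

Let h_trunc s : 0 <= s <= (size g)%:R ->
  path_length (h s) (vertex_point (w (Num.truncn s))) (s - (Num.truncn s)%:R)
  /\ ((Num.truncn s < size g)%N -> path_length (h s)
       (vertex_point (w (Num.truncn s).+1)) ((Num.truncn s).+1%:R - s)).
Proof.
move=> /andP[s0 sn]; have /andP[t1 t2] := truncn_itv s0.
have ts : (Num.truncn s <= size g)%N by rewrite -(ler_nat R); lra.
rewrite /h; move: (Num.truncn s) t1 t2 ts => i t1 t2.
rewrite -natr1 in t2 *; rewrite leq_eqVlt => /predU1P[ei|ig].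
  have -> : s = i%:R by rewrite ei in t1 *; lra.
  rewrite subrr edge_point0; split; last by rewrite ei ltnn.
  exact/path_length_nil/vertex_in_graph.
have I01 : 0 <= s - i%:R <= 1 by lra.
split=> [|_].
  have := path_length_edge (adj_w ig) I01 (t := 0).
  by rewrite edge_point0 subr0 ger0_norm ?lexx ?ler01; [apply|lra].
have := path_length_edge (adj_w ig) I01 (t := 1).
rewrite edge_point1 ler0_norm; last by lra.
by rewrite lexx ler01 (_ : - (s - i%:R - 1) = i%:R + 1 - s); [apply|lra].
Qed.

Let h_length s t : 0 <= s -> s <= t -> t <= (size g)%:R ->
  path_length (h s) (h t) (t - s).
Proof.
move=> s0 st tn.
have sI : 0 <= s <= (size g)%:R by lra.
have tI : 0 <= t <= (size g)%:R by lra.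
have [hs1 hs2] := h_trunc sI; have [ht _] := h_trunc tI.
have := le_truncn st; rewrite leq_eqVlt => /predU1P[e|ij].
  have /andP[s1 _] := truncn_itv s0.
  have /andP[_ t2] := truncn_itv (le_trans s0 st).
  rewrite /h -e; rewrite -{}e -natr1 in t2 *; set i := Num.truncn s in s1 t2 *.
  have : (i <= size g)%N by rewrite -(ler_nat R); lra.
  rewrite leq_eqVlt => /predU1P[ei|ig].
    have -> : s = i%:R by rewrite ei in s1 *; lra.
    have -> : t = i%:R by rewrite ei in s1 *; lra.
    by rewrite !subrr edge_point0; exact/path_length_nil/vertex_in_graph.
  have := @path_length_edge _ _ (s - i%:R) (t - i%:R) (adj_w ig).
  rewrite distrC ger0_norm; last by lra.
  by rewrite opprB addrA subrK; apply; lra.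
(* On different edges, the path runs from [h s] to the next vertex, along the walk to the last
   vertex before [h t], and then to [h t]. *)
have tg : (Num.truncn t <= size g)%N.
  by rewrite -(ler_nat R); have := truncn_itv (le_trans s0 st); lra.
have w1 : walkn (Num.truncn t - (Num.truncn s).+1)
    (w (Num.truncn s).+1) (w (Num.truncn t)) by apply: walk_w; rewrite ij.
have := path_length_cat (hs2 (leq_trans ij tg))
  (path_length_cat (path_length_walk w1) (path_length_sym ht)).
by congr path_length; rewrite natrB //; lra.
Qed.

(** The last two clauses serve to pass between the sides of a geodesic triangle and vertices: the
    side contains the vertices of the walk and stays within [1] of them. *)
Lemma geodesic_of_walk : exists S,
  [/\ geodesic (@dist R G) X (vertex_point x) (vertex_point y) S,
      forall z, z \in x :: g -> S (vertex_point z) &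
      forall p, S p -> exists z l,
        [/\ z \in x :: g, l <= 1 & path_length p (vertex_point z) l]].
Proof.
have h0 : h 0 = vertex_point x by rewrite /h truncn0 subr0 edge_point0.
have hn i : h i%:R = vertex_point (w i).
  by rewrite /h natrK subrr edge_point0.
have wy : w (size g) = y by case: wg => _ <-; rewrite /w nth_last.
have hX s : 0 <= s <= (size g)%:R -> X (h s).
  by move=> /andP[s0 sn]; exact: path_length_in_graph (h_length s0 (lexx s) sn).
exists [set h s | s in [set s : R | 0 <= s <= (size g)%:R]]; split.
- exists (size g)%:R, h; split=> //.
  + by rewrite hn wy.
  + suff H s t : 0 <= s -> s <= t -> t <= (size g)%:R ->
        dist (h s) (h t) = (t - s)%:E /\ dist (h t) (h s) = (t - s)%:E.
      move=> s t /andP[s0 sn] /andP[t0 tn]; have [st|/ltW ts] := leP s t.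
        by rewrite (H s t s0 st tn).1 distrC ger0_norm // subr_ge0.
      by rewrite (H t s t0 ts sn).2 ger0_norm // subr_ge0.
    move=> s0 st tn.
    (* A path shorter than [t - s] would complete to one from [x] to [y] shorter than
       [gdist x y]. *)
    have lo l : path_length (h s) (h t) l -> t - s <= l.
      have := h_length (lexx 0) s0 (le_trans st tn); rewrite h0 => p1 p2.
      have p3 := h_length (le_trans s0 st) tn (lexx _).
      rewrite hn wy in p3.
      have := gdist_path_length (path_length_cat (path_length_cat p1 p2) p3).
      by rewrite -sg; lra.
    have up := h_length s0 st tn.
    split; apply/eqP; rewrite eq_le; apply/andP; split.
    * exact: dist_le.
    * exact: le_dist.
    * exact/dist_le/path_length_sym.
    * by apply: le_dist => l /path_length_sym; exact: lo.
  + by split=> // _ [s sI <-]; exact: hX.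
- move=> z zg; exists (index z (x :: g))%:R.
    apply/andP; rewrite ler0n ler_nat; split=> //.
    by rewrite -ltnS -[(size g).+1]/(size (x :: g)) index_mem.
  by rewrite hn /w nth_index.
- move=> _ [s sI <-]; exists (w (Num.truncn s)), (s - (Num.truncn s)%:R).
  have /andP[s0 sn] := sI; have /andP[t1 t2] := truncn_itv s0.
  split; [|by rewrite -natr1 in t2; lra|by have [] := h_trunc sI].
  by rewrite mem_nth //= ltnS -(ler_nat R); lra.
Qed.

End Geodesic.
End MetricGraph.

(** * Thin triangles and the four-point condition *)

Lemma lty_bound (R : realType) (e : \bar R) : (e < +oo)%E ->
  exists M : R, (e <= M%:E)%E.
Proof.
case: e => [r _|//|_]; first by exists r.
by exists 0; rewrite leNye.
Qed.

Lemma le_truncnS (R : realType) (x r : R) (n : nat) :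
  n%:R <= r -> r <= x -> (n <= (Num.truncn x).+1)%N.
Proof.
move=> nr rx; have x0 : 0 <= x.
  by apply: le_trans rx; apply: le_trans nr; rewrite ler0n.
by rewrite ltnW // ltnS truncn_ge_nat // (le_trans nr).
Qed.

Lemma component_connected (R : realType) (G : sgraph) (x : G) :
  (forall x y : G, joined x y) -> component x = metric_graph setT :> set (G -> R).
Proof.
move=> conn; rewrite /component (_ : [set y | joined x y] = setT) //.
by apply/seteqP; split=> // y _; exact: conn.
Qed.

Lemma hyperbolic_slim (R : realType) (G : sgraph) :
  connected_graph G -> hyperbolic R G -> exists D, slim G D.
Proof.
(* In [M + 2], one unit makes the bounds strict, so that the infima yield an actual path, and one
   moves its end to a vertex. *)
move=> [_ conn] /lty_bound[M hM]; exists (Num.truncn (M + 2)).+1 => x y z p bp.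
(* As [p] is between [x] and [y], shortest walks through [p] concatenate to a shortest walk, so a
   side can be made to contain [p]. *)
have [p1 [w1 l1] s1] := walkn_gdist (conn x p).
have [p2 [w2 l2] s2] := walkn_gdist (conn p y).
have wg : is_walk x y (p1 ++ p2) by split; rewrite ?cat_path ?last_cat l1 ?w1.
have sg : size (p1 ++ p2) = gdist x y by rewrite size_cat s1 s2.
have [A [gA A1 _]] := geodesic_of_walk R wg sg.
have [g2 wg2 [sg2 _]] := shortest_walk conn y z.
have [B [gB _ B2]] := geodesic_of_walk R wg2 sg2.
have [g3 wg3 [sg3 _]] := shortest_walk conn z x.
have [C [gC _ C2]] := geodesic_of_walk R wg3 sg3.
have : (delta_triangle (@dist R G) A B C < (M + 1)%:E)%E.
  apply: (@le_lt_trans _ _ M%:E); last by rewrite lte_fin; lra.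
  apply: le_trans hM; apply: (@le_trans _ _ (delta_space (@dist R G) (component x))).
    apply: ereal_sup_ubound; exists A, B, C; split=> //.
    rewrite component_connected //.
    by exists (vertex_point R x), (vertex_point R y), (vertex_point R z).
  by apply: ereal_sup_ubound; exists x.
case/ereal_inf_lt=> _ [d [d0 [thA _ _]] <-]; rewrite lte_fin => dM.
have Ap : A (vertex_point R p).
  by apply: A1; rewrite -cat_cons mem_cat -l1 mem_last.
have : (dist_set (@dist R G) (vertex_point R p) (B `|` C) < (M + 1)%:E)%E.
  by apply: le_lt_trans (thA _ Ap) _; rewrite lte_fin.
case/ereal_inf_lt=> _ [q qBC <-] /dist_lt[l lM pq].
have close v k : k <= 1 -> path_length q (vertex_point R v) k ->
    (gdist p v <= (Num.truncn (M + 2)).+1)%N.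
  move=> k1 qv; apply: (@le_truncnS R _ (l + k)); last lra.
  exact/gdist_path_length/(path_length_cat pq).
case: qBC => [/B2|/C2] [v [k [vg k1 qv]]]; exists v; split; try exact: close qv.
  by right; exact: walk_between wg2 sg2 vg.
by left; apply: between_sym => //; exact: walk_between wg3 sg3 vg.
Qed.

(** * Spaces whose distance is close to that of a four-point graph *)

Section Thin.
Variables (R : realType) (T : Type) (d : T -> T -> \bar R) (X : set T).
Variables (G : sgraph) (f : T -> G) (c : R) (k : nat).
Hypothesis conn : forall x y : G, joined x y.
Hypothesis fp : four_point G k.
Hypothesis c0 : 0 <= c.
Hypothesis approx : forall p q, X p -> X q ->
  exists r, d p q = r%:E /\ `|r - (gdist (f p) (f q))%:R| <= c.
Local Notation rho p q := ((gdist (f p) (f q))%:R : R).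

Lemma four_point_case p q x y :
  rho p q + rho x y <= rho p x + rho y q + k%:R \/
  rho p q + rho x y <= rho p y + rho x q + k%:R.
Proof.
have := fp (f p) (f x) (f q) (f y); rewrite -!natrD !ler_nat.
rewrite (gdist_sym conn (f q) (f y)).
by case: (leqP (gdist (f x) (f q) + gdist (f p) (f y))
  (gdist (f p) (f x) + gdist (f y) (f q))) => h; [left|right]; lia.
Qed.

Lemma rho_sym p q : rho p q = rho q p.
Proof. by rewrite gdist_sym. Qed.

Lemma approx_bounds p q r : X p -> X q -> d p q = r%:E ->
  rho p q - c <= r <= rho p q + c.
Proof.
move=> Xp Xq e; have [r' [e' le]] := approx Xp Xq.
move: e'; rewrite e => -[->]; move: le; rewrite ler_norml; lra.
Qed.

(** When the detour from [y] to [z] through [p] costs at most [e], the point of the side as far from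
    [y] as [p] is must be close to [p]: apply the four-point condition to these two points, [y] and
    [z]. *)
Lemma near_geodesic y z S p e : geodesic d X y z S -> X p -> 0 <= e ->
  rho y p + rho p z <= rho y z + e ->
  exists2 q, S q & (d p q <= (k%:R + 3 * c + e)%:E)%E.
Proof.
move=> [L [h [L0 hy hz hd [-> SX]]]] Xp e0 le.
have hX s : 0 <= s <= L -> X (h s) by move=> sI; apply: SX; exists s.
(* The minimum keeps the parameter on the side, since [rho y p] may exceed [L]. *)
pose a := Num.min (rho y p) L.
have aI : 0 <= a <= L by rewrite le_min ler0n L0 ge_min lexx orbT.
have I0 : (0 : R) <= 0 <= L by rewrite lexx L0.
have IL : 0 <= L <= L by rewrite lexx L0.
exists (h a); first by exists a.
have [r [-> rle]] := approx Xp (hX _ aI); rewrite lee_fin.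
have := approx_bounds (hX _ I0) (hX _ IL) (hd _ _ I0 IL).
have := approx_bounds (hX _ I0) (hX _ aI) (hd _ _ I0 aI).
have := approx_bounds (hX _ aI) (hX _ IL) (hd _ _ aI IL).
rewrite hy hz !sub0r !normrN (ger0_norm L0) (ger0_norm (andP aI).1).
rewrite ler0_norm; last by case/andP: aI; lra.
have al : a <= rho y p by rewrite ge_min lexx.
have ac : a = rho y p \/ a = L by rewrite /a; case: leP; auto.
move: rle; rewrite ler_norml => /andP[_ rle].
have := four_point_case p (h a) y z.
rewrite (rho_sym p y) (rho_sym z).
have := ler0n R (gdist (f p) (f z)); clearbody a.
by move=> z0 [] H2 H3 H4 H5; case: ac => ea; lra.
Qed.

Lemma geodesic_triangle_side x y z A B C :
  geodesic d X x y A -> geodesic d X y z B -> geodesic d X z x C ->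
  forall p, A p ->
  (dist_set d p (B `|` C) <= (2 * k%:R + 6 * c)%:E)%E.
Proof.
move=> [L [h [L0 hx hy hd [-> SX]]]] gB gC _ [s sI <-].
have hX t : 0 <= t <= L -> X (h t) by move=> tI; apply: SX; exists t.
have I0 : (0 : R) <= 0 <= L by rewrite lexx L0.
have IL : 0 <= L <= L by rewrite lexx L0.
have := approx_bounds (hX _ I0) (hX _ IL) (hd _ _ I0 IL).
have := approx_bounds (hX _ I0) (hX _ sI) (hd _ _ I0 sI).
have := approx_bounds (hX _ sI) (hX _ IL) (hd _ _ sI IL).
rewrite hx hy !sub0r !normrN (ger0_norm L0) (ger0_norm (andP sI).1).
rewrite ler0_norm; last by case/andP: sI; lra.
move=> H1 H2 H3.
have e0 : 0 <= k%:R + 3 * c by have := ler0n R k; lra.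
have [q Sq dq] : exists2 q, (B `|` C) q &
    (d (h s) q <= (k%:R + 3 * c + (k%:R + 3 * c))%:E)%E.
  (* As [h s] is on the side from [x] to [y], [rho x y] is the sum of its distances to [x] and [y]
     up to [3 * c]. Each case thus bounds by [k + 3 * c] the detour through [h s] on one of the
     other sides. *)
  case: (four_point_case (h s) z x y) => fpc.
    have [|q Bq dq] := near_geodesic gB (hX _ sI) e0; last by exists q; first left.
    by rewrite (rho_sym y (h s)); rewrite (rho_sym (h s) x) in fpc; lra.
  have [|q Cq dq] := near_geodesic gC (hX _ sI) e0; last by exists q; first right.
  by rewrite (rho_sym z (h s)) (rho_sym (h s) x) (rho_sym z x); lra.
apply: (@le_trans _ _ (d (h s) q)); first by apply: ereal_inf_lbound; exists q.
by apply: le_trans dq _; rewrite lee_fin; lra.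
Qed.

Lemma delta_space_le : (delta_space d X <= (2 * k%:R + 6 * c)%:E)%E.
Proof.
apply: ge_ereal_sup => _ [A [B [C [[x [y [z [gA gB gC]]]] ->]]]].
apply: ereal_inf_lbound; exists (2 * k%:R + 6 * c) => //; split.
  by rewrite addr_ge0 ?mulr_ge0 ?ler0n.
split.
- exact: geodesic_triangle_side gA gB gC.
- exact: geodesic_triangle_side gB gC gA.
- exact: geodesic_triangle_side gC gA gB.
Qed.

End Thin.

(** * Bounded diameter, odd closed walks and the conclusion *)

Lemma bounded_gdist (R : realType) (G : sgraph) : connected_graph G ->
  bounded_graph R G -> exists D, forall x y : G, (gdist x y <= D)%N.
Proof.
move=> [_ conn] /lty_bound[M hM]; exists (Num.truncn (M + 1)).+1 => x y.
have : (dist (vertex_point R x) (vertex_point R y) < (M + 1)%:E)%E.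
  apply: (@le_lt_trans _ _ M%:E); last by rewrite lte_fin; lra.
  apply: le_trans hM; apply: ereal_sup_ubound.
  by exists (vertex_point R x), (vertex_point R y); split => //;
    exact: vertex_in_graph.
by case/dist_lt=> l lM /gdist_path_length /le_truncnS; apply; exact: ltW.
Qed.

(** Go to a vertex of a nearby minimal cycle, once round it, and back: the way there counts twice,
    so the parity is that of the cycle. *)
Lemma odd_closed_walks (R : realType) (G : sgraph) (k : nat) (K : R) :
  connected_graph G -> four_point G k ->
  (forall w : G, (dist_minimal_cycles (vertex_point R w) <= K%:E)%E) ->
  exists N, forall x : G, exists n, [/\ (n <= N)%N, odd n & walkn n x x].
Proof.
move=> [_ conn] fp near.
exists (2 * (Num.truncn (K + 2)).+1 + (2 * k + 16))%N => x.
have : (dist_minimal_cycles (vertex_point R x) < (K + 1)%:E)%E.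
  by apply: le_lt_trans (near x) _; rewrite lte_fin; lra.
case/ereal_inf_lt=> _ [c mc <-] /ereal_inf_lt[_ [q qc <-]] /dist_lt[l lK xq].
have [cc oc _] := mc; have /andP[/andP[cyc uc] _] := cc.
have [a ac qa] := cycle_trace_next uc qc.
have [l' /andP[_ l1] qa'] := path_length_near (or_intror (next_cycle cyc ac)) qa.
have xa : (gdist x a <= (Num.truncn (K + 2)).+1)%N.
  apply: (@le_truncnS R _ (l + l')); last by lra.
  exact/gdist_path_length/(path_length_cat xq).
have sc := minimal_cycle_size conn fp mc.
exists (gdist x a + (size c + gdist x a))%N; split.
- by clear -xa sc; lia.
- by rewrite !oddD oc addbC -addbA addbb.
- have w := walkn_gdist (conn x a); apply: (walkn_cat w).
  by apply: walkn_cat (walkn_sym w); exact: odd_cycle_walk.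
Qed.

Theorem theorem2p28 (R : realType) (G1 G2 : sgraph)
    (G1_connected : connected_graph G1) (G2_connected : connected_graph G2)
    (G1_hyperbolic : hyperbolic R G1)
    (G2_nontrivial : ~ trivial_graph G2) (G2_bounded : bounded_graph R G2)
    (near_minimal_cycles : exists2 K : R, 0 < K &
       forall w : G1, (dist_minimal_cycles (vertex_point R w) <= K%:E)%E) :
  hyperbolic R (direct_product G1 G2).
Proof.
have conn1 := G1_connected.2.
have [D0 sl] := hyperbolic_slim G1_connected G1_hyperbolic.
have fp := slim_four_point conn1 sl; set k := (6 * D0.+1)%N in fp.
have [K _ near] := near_minimal_cycles.
have [N oddw] := odd_closed_walks G1_connected fp near.
have [D bd] := bounded_gdist G2_connected G2_bounded.
pose P := direct_product G1 G2.
have shortw (u v : P) := dprod_walk u v conn1 G2_connected G2_nontrivial bd oddw.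
have conn (u v : P) : joined u v by have [n [p wp _] _] := shortw u v; exists p.
(* The lower bound projects a shortest walk of the product to [G1]; the upper one is
   [dprod_walk]. *)
have gd (u v : P) :
    (gdist u.1 v.1 <= gdist u v <= gdist u.1 v.1 + (N + D))%N.
  have [n w le] := shortw u v; rewrite (leq_trans (gdist_le w) le) andbT.
  by case/walkn_dprod: (walkn_gdist (conn u v)) => w1 _; exact: gdist_le w1.
have /choice[f hf] : forall p : P -> R, exists v : P, metric_graph setT p ->
    exists l, 0 <= l <= 1 /\ path_length p (vertex_point R v) l.
  move=> p; have [Xp|nXp] := pselect (metric_graph setT p).
    by have [v h] := path_length_vertex Xp; exists v.
  have [[a] _] := G1_connected; have [[b] _] := G2_connected.
  by exists (a, b) => /nXp.
(* [N + D] compares the distances of the product and of [G1], and [2] pays for replacing points by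
   vertices. *)
set c : R := (N + D)%:R + 2.
have c0 : 0 <= c by rewrite addr_ge0 ?ler0n.
apply: (@le_lt_trans _ _ (2 * k%:R + 6 * c)%:E); last by rewrite ltry.
apply: ge_ereal_sup => _ [x _ <-]; rewrite component_connected //.
apply: (delta_space_le (f := fun p => (f p).1) conn1 fp c0) => p q Xp Xq.
have [a [/andP[_ a1] pa]] := hf p Xp; have [b [/andP[_ b1] qb]] := hf q Xq.
have [r [-> rle]] := dist_approx conn a1 b1 pa qb; exists r; split=> //.
have /andP[] := gd (f p) (f q); rewrite -!(ler_nat R) natrD => h1 h2.
by move: rle; rewrite !ler_norml /c; lra.
Qed.
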